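(* Let $L$ be a set of $n$ great circles on the sphere $S^2$ in general position (no three of them pass through a common pair of antipodal points), and consider the arrangement $\mathcal{A}(L)$ of vertices, edges and faces they determine. Then $C(L)\le 5$; that is, there exists a vertex $v$ of $\mathcal{A}(L)$ such that, if $\ell_1^v,\ell_2^v$ are the two great circles of $L$ passing through $v$, the face of the arrangement $\mathcal{A}(L\setminus\{\ell_1^v,\ell_2^v\})$ containing the point $v$ has size at most $5$.
   Context: For a set of great circles $L$ on the sphere, $\mathcal{A}(L)$ denotes the induced cell decomposition of the sphere; its vertices are the intersection points of pairs of circles in $L$. The size of a face is its number of edges (equivalently, of vertices on its boundary). For a vertex $v$ lying on the circles $\ell_1^v,\ell_2^v\in L$, $C(v)$ is the size of the face of $\mathcal{A}(L\setminus\{\ell_1^v,\ell_2^v\})$ containing $v$, and $C(L)=\min_v C(v)$ over all vertices $v$ of $\mathcal{A}(L)$ (so $L$ contains at least two circles). *)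

(* Defs.v *)
From HB Require Import structures.
From mathcomp Require Import all_boot all_order all_algebra.
From mathcomp Require Import boolp reals.
Set Implicit Arguments. Unset Strict Implicit. Unset Printing Implicit Defensive.
Import Order.TTheory GRing.Theory Num.Theory.
Local Open Scope ring_scope.

Definition dot3 {R : realType} (a b : 'rV[R]_3) : R := \sum_(k < 3) a 0 k * b 0 k.

Definition on_sphere {R : realType} (p : 'rV[R]_3) : Prop := dot3 p p = 1.

Definition on_circle {R : realType} (u p : 'rV[R]_3) : Prop :=
  on_sphere p /\ dot3 u p = 0.

Definition great_circle_family {R : realType} (n : nat) (u : 'I_n -> 'rV[R]_3) : Prop :=
  (forall i, u i != 0) /\
  (forall i j, i != j -> exists p, on_circle (u i) p /\ ~ on_circle (u j) p).

Definition general_position {R : realType} (n : nat) (u : 'I_n -> 'rV[R]_3) : Prop :=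
  forall i j k : 'I_n, i != j -> j != k -> i != k ->
    ~ (exists p, on_circle (u i) p /\ on_circle (u j) p /\ on_circle (u k) p).

Definition is_vertex_on {R : realType} (n : nat) (u : 'I_n -> 'rV[R]_3)
  (i j : 'I_n) (v : 'rV[R]_3) : Prop :=
  i != j /\ on_circle (u i) v /\ on_circle (u j) v.

(* The face of the arrangement of the sub-family S containing a point v lying on
   none of the circles of S is the open cell
     { p in S^2 | for all m in S, <u m, p> has the same sign as <u m, v> }.
   Its edges are the maximal arcs of its boundary; the part of the boundary on
   circle k in S is
     { p on circle k | for all m in S, m <> k, <u m, p> has the sign of <u m, v> },
   which is a (possibly empty) single connected arc, since the cell is an
   intersection of open hemispheres.  Hence the size (number of edges) of the
   face equals the number of circles k of S for which this set is nonempty. *)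
Definition face_edge_circle {R : realType} (n : nat) (u : 'I_n -> 'rV[R]_3)
  (S : {set 'I_n}) (v : 'rV[R]_3) (k : 'I_n) : Prop :=
  k \in S /\
  exists p, on_circle (u k) p /\
    forall m, m \in S -> m != k -> 0 < dot3 (u m) p * dot3 (u m) v.

Definition face_size {R : realType} (n : nat) (u : 'I_n -> 'rV[R]_3)
  (S : {set 'I_n}) (v : 'rV[R]_3) : nat :=
  #|[set k : 'I_n | `[< face_edge_circle u S v k >] ]|.

Definition Cv {R : realType} (n : nat) (u : 'I_n -> 'rV[R]_3)
  (i j : 'I_n) (v : 'rV[R]_3) : nat :=
  face_size u (~: [set i; j]) v.

(* Main.v *)
Require Import Defs.
From HB Require Import structures.
From mathcomp Require Import all_boot all_order all_algebra.
From mathcomp Require Import boolp reals.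
From mathcomp Require Import zify ring lra.
Import Order.TTheory GRing.Theory Num.Theory.
Set Implicit Arguments.
Unset Strict Implicit.
Unset Printing Implicit Defensive.
Local Open Scope ring_scope.

(* Removing the two circles through a vertex v merges its four faces into one
   face, and C(v) is at most the total size of the four faces minus 12. Suppose
   this total is at least 18 at every vertex. Since the arrangement is 4-regular
   and has more faces than vertices, the sum of (size - 4) over the faces is
   negative, and discharging contradicts this. Each face of size s >= 5 gives
   at most (s - 4)/s to each of its corners, and each vertex passes what it
   receives on to its triangles; every triangle must receive at least 1. Euler's
   relation alone does not suffice: the further input is that two circles meet
   only in antipodal points, so that (for at least five circles) no two
   triangles share an edge and no quadrilateral has triangles on two opposite
   edges. Hence a quadrilateral with triangles on two consecutive edges can
   convey 1/14 to the common corner of these edges from the opposite corner,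
   at which it has no edge in common with a triangle. *)

(** * Numerical part of the discharging *)

(* All charges are multiplied by 210. *)
Definition weight (s : nat) : int :=
  if (s < 5)%N then 0 else nth 105 [:: 42; 70; 90] (s - 5).

(* A lower bound for the charge which a face of size [s] gives to a corner, when
   the faces across its two edges at that corner have sizes [a] and [b]. *)
Definition corner_bound (s a b : nat) : int :=
  if s == 4%N then
    if (a == 3%N) && (b == 3%N) then 15
    else if (a == 3%N) || (b == 3%N) then 0 else - 15
  else weight s.

(* [s0], [s1], [s2], [s3] are the sizes of the faces around the vertex, in cyclic
   order. *)
Definition vertex_bound (s0 s1 s2 s3 : nat) : int :=
  corner_bound s0 s1 s3 + corner_bound s1 s0 s2
  + corner_bound s2 s1 s3 + corner_bound s3 s0 s2.

(* Twice the fraction of the charge of a vertex which goes to a face of size [s]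
   there, [o] being the size of the opposite face at the vertex. *)
Definition triangle_share (s o : nat) : int :=
  if s == 3%N then if o == 3%N then 1 else 2 else 0.

(* Sizes beyond 8 behave like 8, which leaves finitely many cases. *)
Lemma weight_cap s : weight (minn s 8) = weight s.
Proof.
case: (leqP s 8) => // lt8s; rewrite /weight.
have -> : (s < 5)%N = false by lia.
by rewrite /= nth_default //=; lia.
Qed.

Lemma eq_cap s k : (k < 8)%N -> (minn s 8 == k) = (s == k).
Proof. by move=> k8; lia. Qed.

Lemma corner_bound_cap s a b :
  corner_bound (minn s 8) (minn a 8) (minn b 8) = corner_bound s a b.
Proof. by rewrite /corner_bound !eq_cap // weight_cap. Qed.

Lemma vertex_bound_cap s0 s1 s2 s3 :
  vertex_bound (minn s0 8) (minn s1 8) (minn s2 8) (minn s3 8)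
  = vertex_bound s0 s1 s2 s3.
Proof. by rewrite /vertex_bound !corner_bound_cap. Qed.

Lemma mem_cap m s : (m <= s)%N -> (m <= 8)%N -> minn s 8 \in iota m (9 - m).
Proof. by rewrite mem_iota; lia. Qed.

(** A vertex without triangles passes nothing on; [share_total] needs its charge to be
    nonnegative. *)
Lemma vertex_bound_ge0 s0 s1 s2 s3 :
  (3 < s0)%N -> (3 < s1)%N -> (3 < s2)%N -> (3 < s3)%N ->
  (18 <= s0 + s1 + s2 + s3)%N -> 0 <= vertex_bound s0 s1 s2 s3.
Proof.
move=> h0 h1 h2 h3 hs; rewrite -vertex_bound_cap.
have hs' : (18 <= minn s0 8 + minn s1 8 + minn s2 8 + minn s3 8)%N by lia.
have : all (fun a => all (fun b => all (fun c => all (fun d =>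
   (18 <= a + b + c + d)%N ==> (0 <= vertex_bound a b c d)) (iota 4 5))
   (iota 4 5)) (iota 4 5)) (iota 4 5) by vm_compute.
move=> /allP/(_ _ (mem_cap h0 isT)) /allP/(_ _ (mem_cap h1 isT)).
move=> /allP/(_ _ (mem_cap h2 isT)) /allP/(_ _ (mem_cap h3 isT)).
by rewrite hs'.
Qed.

(** The worst case over the size [o] of the opposite face; 15 is 18 less the size of the triangle,
    and 1000 merely starts the minimum. *)
Definition triangle_corner_bound (a b : nat) : int :=
  foldr Num.min 1000
    [seq triangle_share 3 o * vertex_bound 3 a o b
       | o <- iota 3 6 & (15 <= a + b + o)%N].

Lemma foldr_min_le (x0 x : int) (r : seq int) :
  x \in r -> foldr Num.min x0 r <= x.
Proof.
elim: r => //= y r IH; rewrite inE => /predU1P[->|/IH h].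
  by rewrite ge_min lexx.
by rewrite ge_min h orbT.
Qed.

Lemma triangle_corner_boundP a b o :
  (3 < a)%N -> (3 < b)%N -> (2 < o)%N -> (18 <= 3 + a + o + b)%N ->
  triangle_corner_bound (minn a 8) (minn b 8)
    <= triangle_share 3 o * vertex_bound 3 a o b.
Proof.
move=> ha hb ho hs; rewrite -vertex_bound_cap.
have -> : triangle_share 3 o = triangle_share 3 (minn o 8).
  by rewrite /triangle_share eq_cap.
apply: foldr_min_le; apply/mapP; exists (minn o 8) => //.
by rewrite mem_filter mem_cap // andbT; lia.
Qed.

(** Minimizing over the opposite faces leaves 125 cases. The required charge 1 is 420, by the scale
    210 and the doubled shares. *)
Lemma triangle_bound a b c oab obc oac :
  (3 < a)%N -> (3 < b)%N -> (3 < c)%N ->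
  (2 < oab)%N -> (2 < obc)%N -> (2 < oac)%N ->
  (18 <= 3 + a + oab + b)%N -> (18 <= 3 + b + obc + c)%N ->
  (18 <= 3 + a + oac + c)%N ->
  420 <= triangle_share 3 oab * vertex_bound 3 a oab b
       + triangle_share 3 obc * vertex_bound 3 b obc c
       + triangle_share 3 oac * vertex_bound 3 a oac c.
Proof.
move=> ha hb hc hab hbc hac sab sbc sac.
have := triangle_corner_boundP ha hb hab sab.
have := triangle_corner_boundP hb hc hbc sbc.
have := triangle_corner_boundP ha hc hac sac.
have : all (fun a => all (fun b => all (fun c =>
   420 <= triangle_corner_bound a b + triangle_corner_bound b c
          + triangle_corner_bound a c) (iota 4 5)) (iota 4 5)) (iota 4 5).
  by vm_compute.
move=> /allP/(_ _ (mem_cap ha isT)) /allP/(_ _ (mem_cap hb isT)).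
move=> /allP/(_ _ (mem_cap hc isT)).
by lia.
Qed.

(** * Discharging in an abstract system of faces and corners *)

Section CornerSystem.

Variable n : nat.
Notation sgn := {ffun 'I_n -> bool}.

Definition flip (i : 'I_n) (s : sgn) : sgn := [ffun k => s k (+) (k == i)].

Lemma flipK i : involutive (flip i).
Proof. by move=> s; apply/ffunP => k; rewrite !ffunE -addbA addbb addbF. Qed.

Lemma flipC i j s : flip i (flip j s) = flip j (flip i s).
Proof. by apply/ffunP => k; rewrite !ffunE addbAC. Qed.

Lemma flip_id i s : flip i s i = ~~ s i.
Proof. by rewrite ffunE eqxx addbT. Qed.

Lemma flip_neq i k s : k != i -> flip i s k = s k.
Proof. by move=> ki; rewrite ffunE (negbTE ki) addbF. Qed.

(* A face is given by its sign vector with respect to the circles, and [cor s i j]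
   states that the circles [i] and [j] meet in a corner of the face [s]; the other
   three faces at that vertex arise from [s] by flipping the signs at [i] and [j].
   Sign vectors without corners belong to no face. *)
Variable cor : sgn -> rel 'I_n.

Definition edges (s : sgn) : {set 'I_n} := [set i | [exists j, cor s i j]].
Definition size_face (s : sgn) := #|edges s|.

Hypothesis cor_irr : forall s i, cor s i i = false.
Hypothesis cor_sym : forall s i j, cor s i j = cor s j i.
Hypothesis cor_flip : forall s i j, cor (flip i s) i j = cor s i j.
Hypothesis cor_deg : forall s i j, cor s i j -> #|[set k | cor s i k]| = 2%N.
(** Two circles meet in antipodal points: faces at the same point agree at every other circle, faces
    at antipodes at none. *)
Hypothesis cor_uniq : forall s t i k m l,
  cor s i k -> cor t i k -> m != i -> m != k -> l != i -> l != k ->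
  (s m == t m) = (s l == t l).
Hypothesis n_gt4 : (4 < n)%N.

Local Notation sz := size_face.

(** * Triangles and quadrilaterals *)

Lemma cor_flipr s i j : cor (flip j s) i j = cor s i j.
Proof. by rewrite cor_sym cor_flip cor_sym. Qed.

Lemma cor_neq s i j : cor s i j -> i != j.
Proof. by apply: contraTneq => ->; rewrite cor_irr. Qed.

Lemma cor_edge s i j : cor s i j -> i \in edges s.
Proof. by move=> c; rewrite inE; apply/existsP; exists j. Qed.

Lemma cor_edger s i j : cor s i j -> j \in edges s.
Proof. by rewrite cor_sym; apply: cor_edge. Qed.

Lemma edge_deg s i : i \in edges s -> #|[set k | cor s i k]| = 2%N.
Proof. by rewrite inE => /existsP[j /cor_deg]. Qed.

Lemma nbr_sub s i : [set k | cor s i k] \subset edges s :\ i.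
Proof.
apply/subsetP => k; rewrite !inE => c; rewrite eq_sym (cor_neq c) /=.
by apply/existsP; exists i; rewrite cor_sym.
Qed.

Lemma size_ge3 s i : i \in edges s -> (2 < sz s)%N.
Proof.
move=> ie; have := subset_leq_card (nbr_sub s i).
by rewrite (edge_deg ie) /size_face (cardsD1 i (edges s)) ie.
Qed.

Lemma triangle_cor s i j : sz s = 3%N -> i \in edges s -> j \in edges s ->
  i != j -> cor s i j.
Proof.
move=> s3 ie je ij.
have /eqP E : [set k | cor s i k] == edges s :\ i.
  rewrite eqEcard nbr_sub (edge_deg ie).
  by move: s3; rewrite /size_face (cardsD1 i (edges s)) ie add1n => -[->].
have : j \in edges s :\ i by rewrite in_setD1 eq_sym ij.
by rewrite -E inE.
Qed.

Lemma other_nbr s i j : cor s i j ->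
  exists k, [/\ cor s i k, k != j & [set l | cor s i l] = [set j; k]].
Proof.
move=> c; have /eqP/cards2P[a [b [ab E]]] := cor_deg c.
have : j \in [set l | cor s i l] by rewrite inE.
rewrite E !inE => /orP[] /eqP ->.
  exists b; split=> //; last by rewrite eq_sym.
  by have := set22 a b; rewrite -E inE.
exists a; split=> //; last by rewrite setUC.
by have := set21 a b; rewrite -E inE.
Qed.

Lemma triangleP s i j : sz s = 3%N -> cor s i j ->
  exists k, [/\ cor s i k, cor s j k & edges s = [set i; j; k]].
Proof.
move=> s3 c; have [k [ck kj _]] := other_nbr c.
have ij := cor_neq c; have ik := cor_neq ck.
exists k; split=> //.
  by apply: triangle_cor; rewrite ?(cor_edger c) ?(cor_edger ck) // eq_sym.
apply/esym/eqP; rewrite eqEcard; apply/andP; split.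
  by rewrite !subUset !sub1set (cor_edge c) (cor_edger c) (cor_edger ck).
rewrite -/(sz s) s3 setUC cardsU1 cards2 ij !inE.
by rewrite eq_sym (negbTE ik) (negbTE kj).
Qed.

(** Provides a circle at which two given faces agree; if they differ at another one, [cor_uniq]
    forbids both to have a corner on the same two remaining circles. *)
Lemma fresh a b c d : exists l : 'I_n, [/\ l != a, l != b, l != c & l != d].
Proof.
case: (pickP [predC [:: a; b; c; d]]) => [l|E].
  by rewrite /= !inE !negb_or => /and4P[? ? ? ?]; exists l.
have := card_size [:: a; b; c; d]; rewrite /= leqNgt => /negP[].
rewrite (leq_trans n_gt4) // -[X in (X <= _)%N]card_ord; apply: subset_leq_card.
by apply/subsetP => x _; have := E x; rewrite /= => /negbFE.
Qed.

(* Both apices of two adjacent triangles, or of two triangles on opposite sides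
   of a quadrilateral, lie on the same two circles, so the apices would have to
   be antipodal. *)
Lemma triangle_not_adjacent s i j : cor s i j -> sz s = 3%N -> sz (flip i s) <> 3%N.
Proof.
move=> c s3 t3; have [k [ik jk _]] := triangleP s3 c.
have ci : cor (flip i s) i j by rewrite cor_flip.
have ck : cor (flip i s) i k by rewrite cor_flip.
have cjk : cor (flip i s) j k.
  by apply: triangle_cor; rewrite ?(cor_edger ci) ?(cor_edger ck) // (cor_neq jk).
have [l [li lj lk _]] := fresh i j k k.
have := cor_uniq jk cjk (cor_neq c) (cor_neq ik) lj lk.
by rewrite flip_id (flip_neq _ li) eqxx; case: (s i).
Qed.

(** Here [l] is the other neighbour of [i], and the remaining edge [k] does not meet [i], hence
    meets [j] and [l]. *)
Lemma quadP s i j : sz s = 4%N -> cor s i j ->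
  exists k l, [/\ edges s = [set i; j; k; l],
                 [/\ i != j, i != k, i != l, j != k & j != l], k != l,
                 [set x | cor s i x] = [set j; l] /\
                 [set x | cor s j x] = [set i; k] &
                 [set x | cor s k x] = [set j; l] /\
                 [set x | cor s l x] = [set i; k]].
Proof.
move=> s4 c; have ij := cor_neq c.
have [l [cil lj Ei]] := other_nbr c; have il := cor_neq cil.
have ie := cor_edge c; have je := cor_edger c; have le := cor_edger cil.
have [k ke] : exists k, k \in edges s :\: [set i; j; l].
  apply/set0Pn; rewrite -card_gt0 cardsD.
  have := subset_leq_card (subsetIr (edges s) [set i; j; l]).
  rewrite -/(sz s) s4 setUC cardsU1 cards2 ij.
  by case: (l \notin _) => /=; lia.
move: ke; rewrite in_setD !in_setU !in_set1 !negb_or -!andbA => /and4P[ki kj kl ke].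
have E : edges s = [set i; j; k; l].
  apply/esym/eqP; rewrite eqEcard; apply/andP; split.
    by rewrite !subUset !sub1set ie je ke le.
  rewrite -/(sz s) s4 (setUC _ [set l]) cardsU1 (setUC _ [set k]) cardsU1 cards2.
  by rewrite ij !inE !negb_or ki kj (eq_sym l i) il lj (eq_sym l k) kl.
have Ek : [set x | cor s k x] = [set j; l].
  apply/eqP; rewrite eqEcard (edge_deg ke) cards2 (eq_sym j l) lj andbT.
  apply/subsetP => x; rewrite inE => ckx; have := cor_edger ckx.
  rewrite E !inE => /orP[/orP[/orP[]|]|] /eqP Ex; rewrite Ex ?eqxx ?orbT //.
    have : k \in [set x | cor s i x] by rewrite inE cor_sym -Ex.
    by rewrite Ei !inE (negbTE kj) (negbTE kl).
  by move: (cor_neq ckx); rewrite Ex eqxx.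
have ckj : cor s k j by have := set21 j l; rewrite -Ek inE.
have ckl : cor s k l by have := set22 j l; rewrite -Ek inE.
have two x : x \in edges s -> cor s x i -> cor s x k -> [set y | cor s x y] = [set i; k].
  move=> xe xi xk; apply/esym/eqP; rewrite eqEcard (edge_deg xe) cards2 eq_sym ki.
  by rewrite andbT subUset !sub1set !inE xi xk.
exists k, l; split=> //.
- by split; rewrite // 1?eq_sym.
- by split=> //; apply: two => //; rewrite cor_sym.
- by split=> //; apply: two => //; rewrite cor_sym.
Qed.

Lemma quad_opposite s i k a b : sz (flip i s) = 3%N -> sz (flip k s) = 3%N ->
  cor s i a -> cor s i b -> cor s k a -> cor s k b -> a != b -> i != k -> False.
Proof.
move=> ti tk ia ib ka kb ab ik.
have apex x : sz (flip x s) = 3%N -> cor s x a -> cor s x b -> cor (flip x s) a b.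
  move=> t3 xa xb; apply: triangle_cor => //.
    by apply: (@cor_edger _ x); rewrite cor_flip.
  by apply: (@cor_edger _ x); rewrite cor_flip.
have [l [li lk la lb]] := fresh i k a b.
have := cor_uniq (apex i ti ia ib) (apex k tk ka kb) (cor_neq ia) (cor_neq ib) la lb.
rewrite flip_id (flip_neq _ li) (flip_neq _ lk) eqxx (flip_neq _ ik).
by case: (s i).
Qed.

(** Each of the four faces loses its edges on [i] and [j], which makes 8; each edge at the vertex
    ends on a circle that bounds both faces along it and is counted twice, which makes 4. *)
Lemma edges_around_vertex s i j : cor s i j ->
  (#|(edges s :|: edges (flip i s) :|:
      (edges (flip j s) :|: edges (flip i (flip j s)))) :\: [set i; j]| + 12
   <= sz s + sz (flip i s) + sz (flip i (flip j s)) + sz (flip j s))%N.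
Proof.
move=> c; have ij := cor_neq c.
have ci : cor (flip i s) i j by rewrite cor_flip.
have cj : cor (flip j s) i j by rewrite cor_flipr.
have cij : cor (flip i (flip j s)) i j by rewrite cor_flip.
pose far t := edges t :\: [set i; j].
have szE t : cor t i j -> sz t = (#|far t| + 2)%N.
  move=> ct; rewrite /sz -(cardsID [set i; j] (edges t)) addnC; congr (_ + _)%N.
  rewrite (setIidPr _) ?cards2 ?ij //.
  by rewrite subUset !sub1set (cor_edge ct) (cor_edger ct).
have mem t x : cor t i j -> (exists y, cor t x y) -> x != i -> x != j -> x \in far t.
  move=> ct [y cxy] xi xj.
  by rewrite in_setD (cor_edge cxy) !inE negb_or xi xj.
have [k1 [ck1 kj1 _]] := other_nbr c.
have [k2 [ck2 kj2 _]] := other_nbr cj.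
have cs := c; rewrite cor_sym in cs; have csi := ci; rewrite cor_sym in csi.
have [k3 [ck3 ki3 _]] := other_nbr cs.
have [k4 [ck4 ki4 _]] := other_nbr csi.
(* Otherwise [s] and [flip i s], which differ at [i] alone, would both have a corner on [j] and
   [k3]. *)
have k34 : k3 != k4.
  apply/eqP => k34; rewrite -k34 in ck4 ki4.
  have [l [li lj lk _]] := fresh i j k3 k3.
  have ik3 : i != k3 by rewrite eq_sym.
  have := cor_uniq ck3 ck4 ij ik3 lj lk.
  by rewrite flip_id (flip_neq _ li) eqxx; case: (s i).
have in1 : k1 \in far s :&: far (flip i s).
  have k1i : k1 != i by rewrite eq_sym (cor_neq ck1).
  rewrite inE !mem //; first by exists i; rewrite cor_flipr cor_sym.
  by exists i; rewrite cor_sym.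
have in2 : k2 \in far (flip j s) :&: far (flip i (flip j s)).
  have k2i : k2 != i by rewrite eq_sym (cor_neq ck2).
  rewrite inE !mem //; first by exists i; rewrite cor_flipr cor_sym.
  by exists i; rewrite cor_sym.
have in3 : k3 \in far s :&: far (flip j s).
  have k3j : k3 != j by rewrite eq_sym (cor_neq ck3).
  rewrite inE !mem //; first by exists j; rewrite cor_flipr cor_sym.
  by exists j; rewrite cor_sym.
have in4 : k4 \in far (flip i s) :&: far (flip i (flip j s)).
  have k4j : k4 != j by rewrite eq_sym (cor_neq ck4).
  rewrite inE !mem //; first by exists j; rewrite flipC cor_flipr cor_sym.
  by exists j; rewrite cor_sym.
rewrite (szE _ c) (szE _ ci) (szE _ cj) (szE _ cij) !setDUl -!/(far _).
rewrite cardsU (cardsU (far s)) (cardsU (far (flip j s))).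
have c1 : (0 < #|far s :&: far (flip i s)|)%N by rewrite card_gt0; apply/set0Pn; exists k1.
have c2 : (0 < #|far (flip j s) :&: far (flip i (flip j s))|)%N.
  by rewrite card_gt0; apply/set0Pn; exists k2.
have c3 : (2 <= #|(far s :|: far (flip i s)) :&:
                  (far (flip j s) :|: far (flip i (flip j s)))|)%N.
  have <- : #|[set k3; k4]| = 2%N by rewrite cards2 k34.
  apply: subset_leq_card; rewrite subUset !sub1set.
  move: in3 in4; rewrite !in_setI !in_setU => /andP[-> ->] /andP[-> ->].
  by rewrite !orbT.
have l1 := subset_leq_card (subsetIl (far s) (far (flip i s))).
have l2 := subset_leq_card (subsetIl (far (flip j s)) (far (flip i (flip j s)))).
have l3 := subset_leq_card (subsetIl (far s :|: far (flip i s))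
                             (far (flip j s) :|: far (flip i (flip j s)))).
rewrite cardsU in l3; move: c1 c2 c3 l1 l2 l3; clear.
move: #|_ :&: _| #|_ :&: _| #|_ :&: _| => x y z.
by lia.
Qed.

(** * Charges of corners *)

Definition near_triangles s i j := (sz (flip i s) == 3%N) && (sz (flip j s) == 3%N).
(** For a quadrilateral the edges in question meet at the opposite corner, which need not be named
    in this form. *)
Definition far_triangles s i j :=
  [forall k in edges s :\: [set i; j], sz (flip k s) == 3%N].

Definition charge s i j : int :=
  if sz s == 4%N then 15 * (near_triangles s i j)%:R - 15 * (far_triangles s i j)%:R
  else weight (sz s).

Lemma charge_sym s i j : charge s i j = charge s j i.
Proof. by rewrite /charge /near_triangles /far_triangles andbC setUC. Qed.

Lemma far_trianglesE s i j k l :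
  edges s :\: [set i; j] = [set k; l] -> far_triangles s i j = near_triangles s k l.
Proof.
move=> E; rewrite /far_triangles E; apply/forallP/andP => [h|[hk hl] x].
  by split; [have := h k|have := h l]; rewrite !inE eqxx ?orbT.
by apply/implyP; rewrite !inE => /orP[] /eqP ->.
Qed.

(** By [quad_opposite], one triangle beside the corner excludes two beside the opposite corner, so
    only a corner without adjacent triangles can lose 15. *)
Lemma charge_ge s i j : cor s i j ->
  corner_bound (sz s) (sz (flip i s)) (sz (flip j s)) <= charge s i j.
Proof.
move=> c; rewrite /corner_bound /charge /near_triangles.
case: eqP => // s4.
have [k [l [E [ij ik il jk jl] kl [Ei Ej] [Ek El]]]] := quadP s4 c.
have -> : far_triangles s i j = near_triangles s k l.
  apply: far_trianglesE; apply/setP => x; rewrite E !inE.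
  have [->|xi] := eqVneq x i; first by rewrite (negbTE ik) (negbTE il).
  have [->|xj] := eqVneq x j; first by rewrite (negbTE jk) (negbTE jl).
  by [].
have adj x y z w : [set t | cor s x t] = [set y; z] -> [set t | cor s w t] = [set y; z] ->
    y != z -> x != w -> sz (flip x s) = 3%N -> sz (flip w s) = 3%N -> False.
  move=> Ex Ew yz xw t3 t3'.
  apply: (@quad_opposite s x w y z) => //.
  - by have := set21 y z; rewrite -Ex inE.
  - by have := set22 y z; rewrite -Ex inE.
  - by have := set21 y z; rewrite -Ew inE.
  - by have := set22 y z; rewrite -Ew inE.
have hik : (sz (flip i s) == 3%N) && (sz (flip k s) == 3%N) = false.
  by apply/negP => /andP[/eqP a /eqP b]; apply: (adj i j l k).
have hjl : (sz (flip j s) == 3%N) && (sz (flip l s) == 3%N) = false.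
  by apply/negP => /andP[/eqP a /eqP b]; apply: (adj j i k l).
move: hik hjl; rewrite /near_triangles.
by do 4!case: (_ == 3%N).
Qed.

Lemma sum_corners s (F : 'I_n -> 'I_n -> int) :
  \sum_i \sum_(j | cor s i j) F i j
  = \sum_(i in edges s) \sum_(j in [set k | cor s i k]) F i j.
Proof.
rewrite [LHS](bigID (mem (edges s))) /= [X in _ + X]big1 ?addr0.
  by apply: eq_bigr => i _; apply: eq_bigl => j; rewrite inE.
move=> i ie; rewrite big_pred0 // => j; apply: contraNF ie; exact: cor_edge.
Qed.

Lemma sum_corners_const s (c : int) :
  \sum_i \sum_(j | cor s i j) c = c *+ (2 * sz s).
Proof.
rewrite sum_corners (eq_bigr (fun=> c *+ 2)) => [|i ie].
  by rewrite sumr_const -mulrnA.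
by rewrite sumr_const (edge_deg ie).
Qed.

(** Both orders of a corner count, so 210 becomes 420. A face of size s >= 5 gives each corner at
    most (s - 4)/s, with equality up to size 8; within a quadrilateral the transfers cancel. *)
Lemma sum_charge_le s : edges s != set0 -> sz s != 3%N ->
  \sum_i \sum_(j | cor s i j) charge s i j <= 420 * ((sz s)%:Z - 4).
Proof.
move=> /set0Pn[i ie] s3; have s_ge := size_ge3 ie.
have [s4|s4] := eqVneq (sz s) 4; last first.
  rewrite (eq_bigr (fun i => \sum_(j | cor s i j) weight (sz s))); last first.
    by move=> a _; apply: eq_bigr => b _; rewrite /charge (negbTE s4).
  rewrite sum_corners_const.
  have [s8|] := leqP 8 (sz s).
    have -> : weight (sz s) = 105 by rewrite -weight_cap (minn_idPr s8).
    by lia.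
  by move: s_ge s3 s4; case: (sz s) => [|[|[|[|[|[|[|[|]]]]]]]].
have [j c] : exists j, cor s i j by move: ie; rewrite inE => /existsP.
have [k [l [E [ij ik il jk jl] kl [Ei Ej] [Ek El]]]] := quadP s4 c.
rewrite s4 subrr mulr0 sum_corners.
have nl : l \notin [set i; j; k] by rewrite !inE !negb_or !(eq_sym l) il jl kl.
have nk : k \notin [set i; j] by rewrite !inE !negb_or !(eq_sym k) ik jk.
rewrite E (setUC _ [set l]) big_setU1 //= (setUC _ [set k]) big_setU1 //=.
rewrite big_setU1 ?inE //= big_set1 Ei Ej Ek El.
rewrite !big_setU1 ?inE //= !big_set1 /charge s4 eqxx.
have far x y z w : edges s = [set x; y; z; w] ->
    far_triangles s x y = near_triangles s z w.
  move=> Ex; have : uniq [:: x; y; z; w].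
    apply/card_uniqP; rewrite -[RHS]s4 /size_face Ex; apply: eq_card => t.
    by rewrite !inE -!orbA.
  rewrite /= !inE !negb_or -!andbA => /and5P[xy xz xw yz /andP[yw _]].
  apply: far_trianglesE; apply/setP => t; rewrite Ex !inE.
  have [->|xi] := eqVneq t x; first by rewrite (negbTE xz) (negbTE xw).
  have [->|xj] := eqVneq t y; first by rewrite (negbTE yz) (negbTE yw).
  by [].
have Eperm x y z w : (forall t, [|| t == x, t == y, t == z | t == w]
      = [|| t == i, t == j, t == k | t == l]) ->
    far_triangles s x y = near_triangles s z w.
  by move=> h; apply: far; apply/setP => t; rewrite E !inE -!orbA h.
rewrite (far i j k l E).
rewrite (@Eperm i l j k) ?(@Eperm j i k l) ?(@Eperm j k i l) ?(@Eperm k j i l)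
  ?(@Eperm k l i j) ?(@Eperm l i j k) ?(@Eperm l k i j);
  try by move=> t; case: (t == i); case: (t == j); case: (t == k); case: (t == l).
rewrite /near_triangles.
case: (sz (flip i s) == 3%N); case: (sz (flip j s) == 3%N);
  by case: (sz (flip k s) == 3%N); case: (sz (flip l s) == 3%N).
Qed.

Definition vertex_charge s i j : int :=
  charge s i j + charge (flip i s) i j + charge (flip i (flip j s)) i j
  + charge (flip j s) i j.

Lemma vertex_charge_flip s i j : vertex_charge (flip i s) i j = vertex_charge s i j.
Proof.
rewrite /vertex_charge flipK (flipC j i s) flipK.
by ring.
Qed.

Lemma vertex_charge_sym s i j : vertex_charge s i j = vertex_charge s j i.
Proof.
rewrite /vertex_charge !(charge_sym _ j i) (flipC j i s).
by ring.
Qed.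

Lemma vertex_charge_flipr s i j : vertex_charge (flip j s) i j = vertex_charge s i j.
Proof. by rewrite vertex_charge_sym vertex_charge_flip vertex_charge_sym. Qed.

Lemma vertex_bound_le s i j : cor s i j ->
  vertex_bound (sz s) (sz (flip i s)) (sz (flip i (flip j s))) (sz (flip j s))
    <= vertex_charge s i j.
Proof.
move=> c; have ci : cor (flip i s) i j by rewrite cor_flip.
have cj : cor (flip j s) i j by rewrite cor_flipr.
have cij : cor (flip i (flip j s)) i j by rewrite cor_flip.
have boundC a b d : corner_bound a b d = corner_bound a d b.
  by rewrite /corner_bound andbC orbC.
rewrite /vertex_bound /vertex_charge.
have := charge_ge c; have := charge_ge ci; have := charge_ge cij.
have := charge_ge cj; rewrite !flipK (flipC j i s).
rewrite -(flipC i j (flip j s)) flipK (boundC (sz (flip j s))).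
rewrite (boundC (sz (flip i (flip j s)))).
by lia.
Qed.

(** * Sums over all corners *)

Definition corner_sum (F : sgn -> 'I_n -> 'I_n -> int) : int :=
  \sum_s \sum_i \sum_(j | cor s i j) F s i j.

Lemma corner_sum_sym F : corner_sum (fun s i j => F s j i) = corner_sum F.
Proof.
apply: eq_bigr => s _; rewrite (exchange_big_dep xpredT) //=.
by apply: eq_bigr => i _; apply: eq_bigl => j; rewrite cor_sym.
Qed.

(** A flip permutes the faces at a vertex, so the term for one face may be replaced by the term for
    its neighbour. *)
Lemma corner_sum_flip F : corner_sum (fun s i j => F (flip i s) i j) = corner_sum F.
Proof.
rewrite /corner_sum exchange_big [RHS]exchange_big; apply: eq_bigr => i _ /=.
rewrite [RHS](reindex_inj (inv_inj (flipK i))); apply: eq_bigr => s _ /=.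
by apply: eq_bigl => j; rewrite cor_flip.
Qed.

Lemma corner_sum_flipr F : corner_sum (fun s i j => F (flip j s) i j) = corner_sum F.
Proof.
rewrite -corner_sum_sym -[RHS]corner_sum_sym.
exact: (corner_sum_flip (fun s i j => F s j i)).
Qed.

Lemma eq_corner_sum F G : (forall s i j, cor s i j -> F s i j = G s i j) ->
  corner_sum F = corner_sum G.
Proof. by move=> FG; do 2!apply: eq_bigr => ? _; apply: eq_bigr => ? /FG. Qed.

Lemma le_corner_sum F G : (forall s i j, cor s i j -> F s i j <= G s i j) ->
  corner_sum F <= corner_sum G.
Proof. by move=> FG; do 2!apply: ler_sum => ? _; apply: ler_sum => ? /FG. Qed.

Lemma corner_sumD F G :
  corner_sum (fun s i j => F s i j + G s i j) = corner_sum F + corner_sum G.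
Proof.
rewrite /corner_sum -big_split; apply: eq_bigr => s _ /=.
by rewrite -big_split; apply: eq_bigr => i _ /=; rewrite -big_split.
Qed.

Lemma corner_sumZ (c : int) F :
  corner_sum (fun s i j => c * F s i j) = c * corner_sum F.
Proof.
rewrite /corner_sum mulr_sumr; apply: eq_bigr => s _.
by rewrite mulr_sumr; apply: eq_bigr => i _; rewrite mulr_sumr.
Qed.

Lemma corner_sum_flip2 F :
  corner_sum (fun s i j => F (flip i (flip j s)) i j) = corner_sum F.
Proof.
by rewrite (corner_sum_flipr (fun s i j => F (flip i s) i j)) corner_sum_flip.
Qed.

Lemma sum_vertex_charge :
  corner_sum vertex_charge = 4 * corner_sum charge.
Proof.
rewrite /vertex_charge !corner_sumD corner_sum_flip corner_sum_flip2.
by rewrite corner_sum_flipr; ring.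
Qed.

(** * Charge received by triangles *)

Hypothesis vertex_ge18 : forall s i j, cor s i j ->
  (18 <= sz s + sz (flip i s) + sz (flip i (flip j s)) + sz (flip j s))%N.

Definition share s i j : int := triangle_share (sz s) (sz (flip i (flip j s))).

(** Triangles at a vertex do not share an edge, so there is one with doubled share 2, or an opposite
    pair with 1 each, or none; in the last case the charge is nonnegative. *)
Lemma share_total s i j : cor s i j ->
  (share s i j + share (flip i s) i j + share (flip i (flip j s)) i j
   + share (flip j s) i j) * vertex_charge s i j <= 2 * vertex_charge s i j.
Proof.
move=> c; have ci : cor (flip i s) i j by rewrite cor_flip.
have cj : cor (flip j s) i j by rewrite cor_flipr.
have cij : cor (flip i (flip j s)) i j by rewrite cor_flip.
have cor_ge t : cor t i j -> (2 < sz t)%N by move/cor_edge/size_ge3.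
have adj t : cor t i j -> sz t = 3%N -> sz (flip i t) <> 3%N /\ sz (flip j t) <> 3%N.
  move=> ct t3; split; first exact: triangle_not_adjacent ct t3.
  by apply: (@triangle_not_adjacent _ _ i); rewrite // cor_sym.
have := adj _ c; have := adj _ ci; have := adj _ cj; have := adj _ cij.
have := vertex_bound_ge0 _ _ _ _ (vertex_ge18 c); have := vertex_bound_le c.
have := cor_ge _ c; have := cor_ge _ ci; have := cor_ge _ cj; have := cor_ge _ cij.
rewrite /share !flipK (flipC j i (flip j s)) !flipK (flipC j i s) !flipK.
move: (vertex_bound _ _ _ _) (vertex_charge _ _ _) => vb vc.
rewrite /triangle_share; move: (sz s) (sz _) (sz _) (sz _) => a b d e.
case: (eqVneq a 3) => [->|a3]; case: (eqVneq b 3) => [->|b3];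
  case: (eqVneq d 3) => [->|d3]; case: (eqVneq e 3) => [->|e3]; by lia.
Qed.

(** Both orders of each of the three corners occur, so the 420 of [triangle_bound] is doubled. *)
Lemma triangle_share_sum s : edges s != set0 -> sz s = 3%N ->
  840 <= \sum_i \sum_(j | cor s i j) share s i j * vertex_charge s i j.
Proof.
move=> /set0Pn[i ie] s3.
have [j c] : exists j, cor s i j by move: ie; rewrite inE => /existsP.
have [k [ck cjk E]] := triangleP s3 c.
have nbr x y z : edges s = [set x; y; z] -> cor s x y -> cor s x z -> y != z ->
    [set t | cor s x t] = [set y; z].
  move=> Ex xy xz yz; apply/esym/eqP.
  rewrite eqEcard (edge_deg (cor_edge xy)) cards2 yz andbT.
  by rewrite subUset !sub1set !inE xy xz.
have Ei := nbr i j k E c ck (cor_neq cjk).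
have Ej : [set t | cor s j t] = [set i; k].
  by apply: nbr; rewrite ?E 1?(setUC [set j]) ?(cor_neq ck) // cor_sym.
have Ek : [set t | cor s k t] = [set i; j].
  apply: nbr; rewrite ?(cor_neq c) //; try by rewrite cor_sym.
  by rewrite E (setUC _ [set k]) setUA.
have nk : k \notin [set i; j].
  by rewrite !inE negb_or !(eq_sym k) (cor_neq ck) (cor_neq cjk).
rewrite sum_corners E (setUC _ [set k]) big_setU1 //= big_setU1 ?inE ?(cor_neq c) //=.
rewrite big_set1 Ei Ej Ek !big_setU1 ?inE ?(cor_neq c) ?(cor_neq ck) ?(cor_neq cjk) //=.
rewrite !big_set1.
have shareC x y : share s x y = share s y x by rewrite /share flipC.
rewrite (shareC k i) (shareC k j) (shareC j i) !(vertex_charge_sym s k) (vertex_charge_sym s j i).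
have lower x y : cor s x y ->
    triangle_share 3 (sz (flip x (flip y s)))
      * vertex_bound 3 (sz (flip x s)) (sz (flip x (flip y s))) (sz (flip y s))
    <= share s x y * vertex_charge s x y.
  move=> xy; rewrite /share s3 -[X in vertex_bound X]s3; apply: ler_wpM2l.
    by rewrite /triangle_share; case: ifP.
  exact: vertex_bound_le.
have := lower _ _ c; have := lower _ _ ck; have := lower _ _ cjk.
have gt3 x y : cor s x y -> (3 < sz (flip x s))%N.
  move=> xy; have := triangle_not_adjacent xy s3.
  have : (2 < sz (flip x s))%N.
    by apply: (@size_ge3 _ x); apply: (@cor_edge _ _ y); rewrite cor_flip.
  by lia.
have gt2 x y : cor s x y -> (2 < sz (flip x (flip y s)))%N.
  by move=> xy; apply: (@size_ge3 _ x); apply: (@cor_edge _ _ y); rewrite cor_flip cor_flipr.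
have g x y (xy : cor s x y) := vertex_ge18 xy; rewrite s3 in g.
have := @triangle_bound _ _ _ _ _ _ (gt3 _ _ c) (gt3 _ _ cjk) (@gt3 k i _)
  (gt2 _ _ c) (gt2 _ _ cjk) (gt2 _ _ ck) (g _ _ c) (g _ _ cjk) (g _ _ ck).
by rewrite cor_sym ck => /(_ isT); lia.
Qed.

(** Let T be the number of triangles, B the sum of size - 4 over the other faces, S the corner sum
    of doubled shares times vertex charges, and C that of the charges. Then 840 T <= S <= 2 C <= 840
    B, so B - T >= 0. *)
Lemma discharging : 0 <= \sum_(s | edges s != set0) ((sz s)%:Z - 4).
Proof.
have H1 : 4 * corner_sum (fun s i j => share s i j * vertex_charge s i j)
    <= 2 * corner_sum vertex_charge.
  have -> : 4 * corner_sum (fun s i j => share s i j * vertex_charge s i j)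
    = corner_sum (fun s i j => (share s i j + share (flip i s) i j
      + share (flip i (flip j s)) i j + share (flip j s) i j) * vertex_charge s i j).
    pose F s i j := share s i j * vertex_charge s i j.
    transitivity (corner_sum F + corner_sum (fun s i j => F (flip i s) i j)
      + corner_sum (fun s i j => F (flip i (flip j s)) i j)
      + corner_sum (fun s i j => F (flip j s) i j)).
      by rewrite corner_sum_flip corner_sum_flip2 corner_sum_flipr -/F; ring.
    rewrite -!corner_sumD; apply: eq_corner_sum => s i j _; rewrite /F.
    by rewrite !vertex_charge_flip !vertex_charge_flipr; ring.
  by rewrite -corner_sumZ; apply: le_corner_sum => s i j; apply: share_total.
rewrite sum_vertex_charge in H1.
have H2 : \sum_(s | (edges s != set0) && (sz s == 3%N)) 840
    <= corner_sum (fun s i j => share s i j * vertex_charge s i j).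
  rewrite [leRHS](bigID (fun s => (edges s != set0) && (sz s == 3%N))) /=.
  rewrite [X in _ <= _ + X]big1 ?addr0 => [|s].
    by apply: ler_sum => s /andP[e /eqP s3]; apply: triangle_share_sum.
  rewrite negb_and negbK => es; rewrite big1 // => i _; rewrite big1 // => j c.
  case/orP: es => [/eqP e|s3]; first by have := cor_edge c; rewrite e inE.
  by rewrite /share /triangle_share (negbTE s3) mul0r.
have H3 : corner_sum charge
    <= \sum_(s | (edges s != set0) && (sz s != 3%N)) 420 * ((sz s)%:Z - 4).
  rewrite [leLHS](bigID (fun s => (edges s != set0) && (sz s != 3%N))) /=.
  rewrite [X in _ + X <= _]big1 ?addr0 => [|s].
    by apply: ler_sum => s /andP[e s3]; apply: sum_charge_le.
  rewrite negb_and !negbK => es; rewrite big1 // => i _; rewrite big1 // => j c.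
  case/orP: es => [/eqP e|/eqP s3]; first by have := cor_edge c; rewrite e inE.
  by rewrite /charge s3.
rewrite (bigID (fun s => sz s == 3%N)) /=.
rewrite (eq_bigr (fun=> -1)) => [|s /andP[_ /eqP ->]] //.
rewrite -mulr_sumr in H3.
have H2' : \sum_(s | (edges s != set0) && (sz s == 3%N)) (840 : int)
    = - 840 * \sum_(s | (edges s != set0) && (sz s == 3%N)) -1.
  by rewrite mulr_sumr; apply: eq_bigr => s _; rewrite mulrNN mulr1.
move: H1 H2 H3; rewrite H2'.
move: (corner_sum charge) (corner_sum _) => C S.
move: (\sum_(s | _ && (_ == _)) _) (\sum_(s | _ && (_ != _)) _) => A B.
by lia.
Qed.

End CornerSystem.

(** * Arrangements as systems of faces and corners *)

Section Cross.

Variable R : realType.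
Implicit Types a b c p h : 'rV[R]_3.

Local Notation o0 := (@ord0 2).
Local Notation o1 := (lift (@ord0 2) (@ord0 1)).
Local Notation o2 := (lift (@ord0 2) (lift (@ord0 1) (@ord0 0))).

Lemma dot3E a b : dot3 a b = a 0 o0 * b 0 o0 + a 0 o1 * b 0 o1 + a 0 o2 * b 0 o2.
Proof. by rewrite /dot3 !big_ord_recl big_ord0 addr0 addrA. Qed.

Definition cross a b : 'rV[R]_3 :=
  \row_k if k == o0 then a 0 o1 * b 0 o2 - a 0 o2 * b 0 o1
         else if k == o1 then a 0 o2 * b 0 o0 - a 0 o0 * b 0 o2
         else a 0 o0 * b 0 o1 - a 0 o1 * b 0 o0.

Definition det3 a b c : R := dot3 (cross a b) c.

Lemma det3E a b c : det3 a b c =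
  (a 0 o1 * b 0 o2 - a 0 o2 * b 0 o1) * c 0 o0
  + (a 0 o2 * b 0 o0 - a 0 o0 * b 0 o2) * c 0 o1
  + (a 0 o0 * b 0 o1 - a 0 o1 * b 0 o0) * c 0 o2.
Proof. by rewrite /det3 dot3E /cross !mxE. Qed.

Lemma dot3C a b : dot3 a b = dot3 b a.
Proof. by rewrite !dot3E; ring. Qed.

Lemma dot3Zl (x : R) a b : dot3 (x *: a) b = x * dot3 a b.
Proof. by rewrite !dot3E !mxE; ring. Qed.

Lemma dot3Dl a b c : dot3 (a + b) c = dot3 a c + dot3 b c.
Proof. by rewrite !dot3E !mxE; ring. Qed.

Lemma det3_swap a b c : det3 b a c = - det3 a b c.
Proof. by rewrite !det3E; ring. Qed.

Lemma det3_swapr a b c : det3 a c b = - det3 a b c.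
Proof. by rewrite !det3E; ring. Qed.

Lemma det3_id a b : det3 a b a = 0.
Proof. by rewrite det3E; ring. Qed.

Lemma det3_idr a b : det3 a b b = 0.
Proof. by rewrite det3E; ring. Qed.

Lemma dot3_ge0 a : 0 <= dot3 a a.
Proof. by rewrite dot3E -!expr2 !addr_ge0 ?sqr_ge0. Qed.

Lemma dot3_eq0 a : dot3 a a = 0 -> a = 0.
Proof.
rewrite dot3E -!expr2 => /eqP.
rewrite paddr_eq0 ?addr_ge0 ?sqr_ge0 // paddr_eq0 ?sqr_ge0 //.
rewrite !sqrf_eq0 => /andP[/andP[/eqP a0 /eqP a1] /eqP a2].
apply/rowP => k; rewrite mxE; case: (unliftP o0 k) => [k' ->|-> //].
case: (unliftP (@ord0 1) k') => [k'' ->|-> //].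
by rewrite (ord1 k'').
Qed.

(** Cramer's rule for [p], paired with [p]: a unit vector orthogonal to [a], [b] and [c] forces
    their determinant to vanish. *)
Lemma cramer a b c p :
  det3 a b c * dot3 p p = dot3 a p * det3 b c p + dot3 b p * det3 c a p
                          + dot3 c p * det3 a b p.
Proof. by rewrite !det3E !dot3E; ring. Qed.

(** The linear relation between four vectors in dimension three, paired with [p]. *)
Lemma plucker a b c d p :
  det3 b c d * dot3 a p - det3 a c d * dot3 b p + det3 a b d * dot3 c p
  - det3 a b c * dot3 d p = 0.
Proof. by rewrite !det3E !dot3E; ring. Qed.

(** By the Binet-Cauchy identity for the product of a x b with a x p. Distinct circles hence have
    normals with nonzero cross product. *)
Lemma cross_eq0 a b p : cross a b = 0 -> a != 0 -> dot3 a p = 0 -> dot3 b p = 0.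
Proof.
move=> X0 a0 ap.
have aa : dot3 a a != 0 by apply: contra a0 => /eqP/dot3_eq0 ->.
have : dot3 (cross a b) (cross a p) = dot3 a a * dot3 b p - dot3 a p * dot3 a b.
  by rewrite !dot3E /cross !mxE /=; ring.
rewrite X0 ap mul0r subr0 -(scale0r (0 : 'rV[R]_3)) dot3Zl mul0r => /esym/eqP.
by rewrite mulf_eq0 (negbTE aa) => /eqP.
Qed.

Definition normalize a : 'rV[R]_3 := (Num.sqrt (dot3 a a))^-1 *: a.

Lemma normalize_sphere a : a != 0 -> on_sphere (normalize a).
Proof.
move=> a0; have aa : dot3 a a != 0 by apply: contra a0 => /eqP/dot3_eq0 ->.
rewrite /on_sphere /normalize dot3Zl dot3C dot3Zl mulrA -expr2 exprVn.
by rewrite sqr_sqrtr ?dot3_ge0 // mulVf.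
Qed.

Lemma inv_norm_gt0 a : a != 0 -> 0 < (Num.sqrt (dot3 a a))^-1.
Proof.
move=> a0; rewrite invr_gt0 sqrtr_gt0 lt_def dot3_ge0 andbT.
by apply: contra a0 => /eqP/dot3_eq0 ->.
Qed.

Lemma on_circle_normalize a b : b != 0 -> dot3 a b = 0 -> on_circle a (normalize b).
Proof.
move=> b0 ab; split; first exact: normalize_sphere.
by rewrite dot3C /normalize dot3Zl dot3C ab mulr0.
Qed.

End Cross.

(** Take [x] of least indegree. If some [y] beat [x], then by acyclicity all that beat [y] would
    beat [x], as does [y] itself, so [y] would have smaller indegree. *)
Lemma tournament_source (T : finType) (D : {set T}) (r : rel T) :
  {in D &, forall x y, x != y -> r y x = ~~ r x y} ->
  {in D & &, forall x y z, uniq [:: x; y; z] -> r x y -> r y z -> ~~ r z x} ->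
  D != set0 -> exists2 x, x \in D & {in D, forall y, y != x -> r x y}.
Proof.
move=> anti acyc /set0Pn[x0 x0D].
pose indeg x := #|[set y in D | (y != x) && r y x]|.
have [x xD xmin] := arg_minnP indeg x0D.
exists x => // y yD yx; apply: contraT => nxy.
have ryx : r y x by rewrite (anti x y) // eq_sym.
have := xmin y yD; rewrite leqNgt => /negP[]; apply: proper_card.
apply/properP; split; last by exists y; rewrite !inE ?yD ?yx ?ryx // eqxx andbF.
apply/subsetP => z; rewrite !inE => /and3P[zD zy rzy]; rewrite zD /=.
have zx : z != x by apply: contraNneq nxy => <-.
rewrite zx /= (anti x z) //; last by rewrite eq_sym.
by apply: acyc rzy ryx; rewrite //= !inE negb_or zy zx yx.
Qed.

(** * Corners in terms of determinants *)

Section Arrangement.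

Variables (R : realType) (n : nat) (u : 'I_n -> 'rV[R]_3).
Notation sgn := {ffun 'I_n -> bool}.
Implicit Types (i j k l m q : 'I_n) (s t : sgn).

Hypothesis n_gt2 : (2 < n)%N.
Hypothesis det_neq0 : forall i j k : 'I_n, i != j -> j != k -> i != k ->
  det3 (u i) (u j) (u k) != 0.

(* The cross product of [u i] and [u j], rather than its antipode, is a corner of
   the face [s]. *)
Definition oriented_corner (s : sgn) (i j : 'I_n) : bool :=
  (i != j) && [forall m, (m != i) && (m != j)
                 ==> (s m == (0 < det3 (u i) (u j) (u m)))].

Definition corner (s : sgn) (i j : 'I_n) : bool :=
  oriented_corner s i j || oriented_corner s j i.

Local Notation D i j m := (det3 (u i) (u j) (u m)).

Lemma oriented_cornerP s i j :
  reflect (i != j /\ forall m, m != i -> m != j -> s m = (0 < D i j m))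
          (oriented_corner s i j).
Proof.
apply: (iffP andP) => -[ij h]; split=> //.
  by move=> m mi mj; have /implyP := forallP h m; rewrite mi mj => /(_ isT)/eqP.
by apply/forallP => m; apply/implyP => /andP[mi mj]; rewrite h.
Qed.

Lemma det_swap_gt0 i j m : i != j -> m != i -> m != j ->
  (0 < D j i m) = ~~ (0 < D i j m).
Proof.
move=> ij mi mj; rewrite det3_swap oppr_gt0 -leNgt le_eqVlt.
by rewrite (negbTE (det_neq0 _ _ _)) // eq_sym.
Qed.

Lemma third (i j : 'I_n) : exists m, (m != i) && (m != j).
Proof.
case: (pickP [pred m | (m != i) && (m != j)]) => [m|E]; first by exists m.
have := subset_leq_card (_ : 'I_n \subset [set i; j]).
rewrite card_ord => /(_ _)/leq_trans h.
have : (n <= 2)%N.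
  apply: h; last by rewrite cards2; case: (i != j).
  by apply/subsetP => m _; have := E m; rewrite /= !inE -negb_or => /negbFE.
by rewrite leqNgt n_gt2.
Qed.

Lemma oriented_corner_asym s i j : oriented_corner s i j -> ~~ oriented_corner s j i.
Proof.
move=> /oriented_cornerP[ij h]; apply/negP => /oriented_cornerP[_ h'].
have [m /andP[mi mj]] := third i j.
have := h' m mj mi; rewrite h // (det_swap_gt0 ij mi mj).
by case: (0 < _).
Qed.

Lemma oriented_corner_flip s i j k : k \in [set i; j] ->
  oriented_corner (flip k s) i j = oriented_corner s i j.
Proof.
move=> kij; congr (_ && _); apply: eq_forallb => m.
have [->|mk] := eqVneq m k; last by rewrite flip_neq.
by move: kij; rewrite !inE => /orP[] /eqP ->; rewrite eqxx ?andbF.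
Qed.

Lemma corner_irr s i : corner s i i = false.
Proof. by rewrite /corner /oriented_corner eqxx. Qed.

Lemma corner_sym s i j : corner s i j = corner s j i.
Proof. by rewrite /corner orbC. Qed.

Lemma corner_flip s i j : corner (flip i s) i j = corner s i j.
Proof. by rewrite /corner !oriented_corner_flip // !inE eqxx ?orbT. Qed.

(** Off [i] and [k] the signs at a corner are those of one of two antipodal points, whose signs are
    opposite throughout. *)
Lemma corner_uniq s t i k m l : corner s i k -> corner t i k ->
  m != i -> m != k -> l != i -> l != k -> (s m == t m) = (s l == t l).
Proof.
move=> /orP[] /oriented_cornerP[ik hs] /orP[] /oriented_cornerP[_ ht] mi mk li lk;
  rewrite !hs // !ht //.
- by rewrite !eqxx.
- by rewrite !(det_swap_gt0 ik) //; do 2!case: (0 < _).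
- by rewrite !(det_swap_gt0 ik) //; do 2!case: (0 < _).
- by rewrite !eqxx.
Qed.

Let sg (b : bool) : R := if b then 1 else -1.

Let sg_mul_gt0 (b : bool) (x : R) : x != 0 -> (0 < sg b * x) = (b == (0 < x)).
Proof.
rewrite /sg => x0; case: b; first by rewrite mul1r; case: (0 < x).
by rewrite mulN1r oppr_gt0 ltNge le_eqVlt eq_sym (negbTE x0) /=; case: (0 < x).
Qed.

(** * The two ends of an edge *)

Section Edge.

(* The circle [i] carries an edge of the face [s] as soon as the closed face
   contains a point [p] of the circle on at most one further circle. *)
Variables (s : sgn) (i : 'I_n) (p : 'rV[R]_3).
Hypothesis on_p : dot3 (u i) p = 0.
Hypothesis p_ge0 : forall m, m != i -> 0 <= sg (s m) * dot3 (u m) p.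
Hypothesis p_generic : forall m l, m != i -> l != i -> m != l ->
  (dot3 (u m) p != 0) || (dot3 (u l) p != 0).

(** Each circle [m] cuts a half circle from [i], on the side given by [s]; [beats] compares these by
    angle. As [p] lies in all their closures, the angular order is linear, and its extremes bound
    the edge. *)
Let beats m l := 0 < sg (s m) * (sg (s l) * D i m l).

Let beats_asym : {in ~: [set i] &, forall m l, m != l -> beats l m = ~~ beats m l}.
Proof.
move=> m l; rewrite !inE => mi li ml; rewrite /beats det3_swapr.
have d0 : D i m l != 0 by rewrite det_neq0 // eq_sym.
rewrite mulrN mulrN oppr_gt0 -leNgt mulrCA le_eqVlt !mulf_eq0 (negbTE d0).
have sg0 b : (sg b == 0) = false by rewrite /sg; case: b; rewrite ?oppr_eq0 oner_eq0.
by rewrite !sg0.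
Qed.

(** Along a cycle, [plucker] at [p] gives nonnegative terms with sum 0; all vanish, and [p] would
    lie on two further circles. *)
Let beats_acyclic : {in ~: [set i] & &, forall m l q, uniq [:: m; l; q] ->
  beats m l -> beats l q -> ~~ beats q m}.
Proof.
move=> m l q; rewrite !inE => mi li qi.
rewrite /= !inE negb_or andbT => /andP[/andP[ml mq] lq]; rewrite /beats => bml blq.
apply/negP => bqm.
have [am al aq] := And3 (p_ge0 mi) (p_ge0 li) (p_ge0 qi).
have sum0 : sg (s l) * (sg (s q) * D i l q) * (sg (s m) * dot3 (u m) p)
    + sg (s q) * (sg (s m) * D i q m) * (sg (s l) * dot3 (u l) p)
    + sg (s m) * (sg (s l) * D i m l) * (sg (s q) * dot3 (u q) p) = 0.
  transitivity (- (sg (s m) * sg (s l) * sg (s q)) *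
    (D m l q * dot3 (u i) p - D i l q * dot3 (u m) p + D i m q * dot3 (u l) p
     - D i m l * dot3 (u q) p)); last by rewrite plucker mulr0.
  by rewrite on_p (det3_swapr (u i) (u m) (u q)); ring.
have sg0 b : (sg b == 0) = false by rewrite /sg; case: b; rewrite ?oppr_eq0 oner_eq0.
have [t1 t2 t3] := And3 (mulr_ge0 (ltW blq) am) (mulr_ge0 (ltW bqm) al)
  (mulr_ge0 (ltW bml) aq).
move/eqP: sum0; rewrite paddr_eq0 ?addr_ge0 // paddr_eq0 //.
move=> /andP[/andP[zm zl] _]; have := p_generic mi li ml.
move: zm zl; rewrite mulf_eq0 (gt_eqF blq) mulf_eq0 sg0 /= => zm.
rewrite mulf_eq0 (gt_eqF bqm) mulf_eq0 sg0 /= => zl.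
by rewrite zm zl.
Qed.

(** The neighbours of [i] are the circle that beats all others and the one beaten by all; they
    differ since at least two circles other than [i] exist. *)
Lemma edge_degree : #|[set j | corner s i j]| = 2%N.
Proof.
have D0 : ~: [set i] != set0.
  have [m /andP[mi _]] := third i i.
  by apply/set0Pn; exists m; rewrite !inE.
have [a] := tournament_source beats_asym beats_acyclic D0.
rewrite !inE => ai amax.
have rasym : {in ~: [set i] &, forall m l, m != l -> beats m l = ~~ beats l m}.
  by move=> m l mD lD ml; rewrite (beats_asym lD mD) // eq_sym.
have racyc : {in ~: [set i] & &, forall m l q, uniq [:: m; l; q] ->
    beats l m -> beats q l -> ~~ beats m q}.
  move=> m l q mD lD qD U lm ql.
  apply: (beats_acyclic qD lD mD) ql lm.
  by rewrite -(rev_uniq [:: m; l; q]) in U.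
have [b] := tournament_source rasym racyc D0.
rewrite !inE => bi bmin.
have ab : a != b.
  have [m /andP[mi ma]] := third i a.
  apply: contraTneq (amax m _ ma); rewrite ?inE // => ab.
  have mD : m \in ~: [set i] by rewrite !inE.
  have aD : a \in ~: [set i] by rewrite !inE.
  rewrite -(beats_asym aD mD); last by rewrite eq_sym.
  by rewrite ab; apply: bmin; rewrite // -ab.
have beatsE m l : m != i -> l != i -> m != l ->
    beats m l = (s m == (s l == (0 < D i m l))).
  move=> mi li ml; have d0 : D i m l != 0 by rewrite det_neq0 // eq_sym.
  rewrite /beats sg_mul_gt0 ?sg_mul_gt0 // mulf_eq0 (negbTE d0) orbF.
  by rewrite /sg; case: (s l); rewrite ?oppr_eq0 oner_eq0.
have cornerP j : j != i -> corner s i j =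
    [forall m, (m != i) && (m != j) ==> beats j m]
    || [forall m, (m != i) && (m != j) ==> ~~ beats j m].
  move=> ji; rewrite /corner /oriented_corner (eq_sym i j) ji /=.
  case sj: (s j); [|rewrite orbC]; congr (_ || _); apply: eq_forallb => m.
  - case: (eqVneq m i) => //= mi; case: (eqVneq m j) => //= mj.
    by rewrite beatsE ?(eq_sym j m) // sj; case: (_ == _).
  - case: (eqVneq m i) => //= mi; case: (eqVneq m j) => //= mj.
    rewrite beatsE ?(eq_sym j m) // sj (@det_swap_gt0 i j m) ?(eq_sym i j) //.
    by case: (s m); case: (0 < _).
  - case: (eqVneq m i) => //= mi; case: (eqVneq m j) => //= mj.
    rewrite beatsE ?(eq_sym j m) // sj (@det_swap_gt0 i j m) ?(eq_sym i j) //.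
    by case: (s m); case: (0 < _).
  - case: (eqVneq m i) => //= mi; case: (eqVneq m j) => //= mj.
    by rewrite beatsE ?(eq_sym j m) // sj; case: (s m); case: (0 < _).
suff -> : [set j | corner s i j] = [set a; b] by rewrite cards2 ab.
apply/setP => j; rewrite !inE.
have [->|ji] := eqVneq j i.
  by rewrite corner_irr (eq_sym i a) (eq_sym i b) (negbTE ai) (negbTE bi).
rewrite cornerP //; apply/idP/idP => [/orP[]|/orP[]].
- move=> /forallP h; have [->//|ja /=] := eqVneq j a.
  have jD : j \in ~: [set i] by rewrite !inE.
  have aD : a \in ~: [set i] by rewrite !inE.
  have := h a; rewrite ai eq_sym ja /= (beats_asym aD jD) 1?eq_sym //.
  by rewrite amax.
- move=> /forallP h; have [->|jb] := eqVneq j b; first by rewrite orbT.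
  have := h b; rewrite bi eq_sym jb /=.
  by rewrite bmin ?inE.
- move=> /eqP->; apply/orP; left; apply/forallP => m; apply/implyP => /andP[mi ma].
  by apply: amax; rewrite ?inE.
- move=> /eqP->; apply/orP; right; apply/forallP => m; apply/implyP => /andP[mi mb].
  have mD : m \in ~: [set i] by rewrite !inE.
  have bD : b \in ~: [set i] by rewrite !inE.
  by rewrite -(beats_asym bD mD) 1?eq_sym //; apply: bmin.
Qed.

End Edge.

Lemma cross_generic i j m l : i != j -> m != i -> l != i -> m != l ->
  (dot3 (u m) (cross (u i) (u j)) != 0) || (dot3 (u l) (cross (u i) (u j)) != 0).
Proof.
move=> ij mi li ml; rewrite !(dot3C (u _)).
have [mj|mj] := eqVneq m j; [apply/orP; right|apply/orP; left].
  by apply: det_neq0; rewrite // 1?eq_sym -?mj // eq_sym.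
by apply: det_neq0; rewrite // eq_sym.
Qed.

Lemma oriented_corner_edge s i j m : oriented_corner s i j ->
  0 <= sg (s m) * dot3 (u m) (cross (u i) (u j)).
Proof.
move=> /oriented_cornerP[ij h]; rewrite dot3C.
have [->|mi] := eqVneq m i; first by rewrite -/(det3 _ _ _) det3_id mulr0.
have [->|mj] := eqVneq m j; first by rewrite -/(det3 _ _ _) det3_idr mulr0.
by apply/ltW; rewrite sg_mul_gt0 ?h ?eqxx // det_neq0 // eq_sym.
Qed.

Lemma corner_degree s i j : corner s i j -> #|[set k | corner s i k]| = 2%N.
Proof.
move=> /orP[] K; have [ij _] := oriented_cornerP _ _ _ K.
  apply: (@edge_degree s i (cross (u i) (u j))).
  - by rewrite dot3C -/(det3 _ _ _) det3_id.
  - by move=> m _; apply: oriented_corner_edge.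
  - by move=> m l mi li ml; apply: cross_generic.
apply: (@edge_degree s i (cross (u j) (u i))).
- by rewrite dot3C -/(det3 _ _ _) det3_idr.
- by move=> m _; apply: oriented_corner_edge.
- move=> m l mi li ml; rewrite !(dot3C (u _)) -!/(det3 _ _ _).
  rewrite !(det3_swap (u i)) !oppr_eq0 /det3 -!(dot3C (u _)).
  by apply: cross_generic; rewrite // eq_sym.
Qed.

(** Doubled, both sides count ordered corners: a corner has exactly one orientation, and an edge has
    two corners. *)
Lemma sum_oriented s :
  (\sum_i \sum_j oriented_corner s i j)%N = size_face corner s.
Proof.
apply/eqP; rewrite -(eqn_pmul2l (isT : 0 < 2)%N); apply/eqP.
transitivity (\sum_i \sum_j corner s i j)%N.
  rewrite mul2n -addnn [X in (_ + X)%N]exchange_big -big_split /=.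
  apply: eq_bigr => i _; rewrite -big_split; apply: eq_bigr => j _ /=.
  rewrite /corner; have := @oriented_corner_asym s i j.
  by case: (oriented_corner s i j) => [/(_ isT)/negbTE->|].
transitivity (\sum_(i in edges corner s) 2)%N; last by rewrite sum_nat_const mulnC.
rewrite [RHS]big_mkcond; apply: eq_bigr => i _.
transitivity #|[set j | corner s i j]|.
  by rewrite -sum1dep_card [RHS]big_mkcond; apply: eq_bigr => j _; case: corner.
rewrite inE; case: existsP => [[j]|E]; first exact: corner_degree.
by apply: eq_card0 => j; rewrite inE; apply/negP => c; case: E; exists j.
Qed.

(** * More faces than vertices, by sweeping *)

Section Sweep.

(* Sweep the sphere by half great circles through [h] and [-h]. Each vertex is
   the first point met by exactly one of its four faces, each face has at most
   one first vertex, and the face containing [h] has none; hence there are more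
   faces than vertices. *)
Variable h : 'rV[R]_3.
Hypothesis h_generic : forall i, dot3 h (u i) != 0.

(** The functional x -> (h.u_j)(u_i.x) - (h.u_i)(u_j.x) vanishes at [h] and at the vertex u_i x u_j;
    the signs say that both of its terms are positive on the face. *)
Definition first_vertex s i j : bool :=
  (s i == (0 < dot3 h (u j))) && (s j == (dot3 h (u i) < 0)).

Let same_sign (x y : R) : x != 0 -> y != 0 -> (0 < x) = (0 < y) -> 0 < x * y.
Proof.
move=> x0 y0; case: (ltgtP 0 x) x0 => // [x_gt|x_lt] _ /esym.
  by move=> y_gt; rewrite mulr_gt0.
move=> /negbT; rewrite -leNgt le_eqVlt (negbTE y0) /= => y_lt.
by rewrite nmulr_rgt0.
Qed.

(** The functional of each first vertex is nonnegative at the other one, yet the two values add up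
    to 0. So all four terms vanish, and [i] and [j] are among [k] and [l]. *)
Lemma first_vertex_uniq s i j k l :
  oriented_corner s i j -> first_vertex s i j ->
  oriented_corner s k l -> first_vertex s k l -> i = k /\ j = l.
Proof.
move=> Kij /andP[/eqP si /eqP sj] Kkl /andP[/eqP sk /eqP sl].
have [ij hij] := oriented_cornerP _ _ _ Kij.
have [kl hkl] := oriented_cornerP _ _ _ Kkl.
have side a b c d : c != d -> s a = (0 < dot3 h (u b)) ->
    (forall m, m != c -> m != d -> s m = (0 < D c d m)) ->
    (0 <= dot3 h (u b) * D c d a) /\
    (dot3 h (u b) * D c d a = 0 -> a = c \/ a = d).
  move=> cd sa hcd.
  have [->|ac] := eqVneq a c; first by rewrite det3_id mulr0; split=> //; left.
  have [->|ad] := eqVneq a d; first by rewrite det3_idr mulr0; split=> //; right.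
  have d0 : D c d a != 0 by rewrite det_neq0 // eq_sym.
  have pos : 0 < dot3 h (u b) * D c d a by rewrite same_sign // -sa hcd.
  by split; [apply: ltW|move=> e; move: pos; rewrite e ltxx].
have side' a b c d : c != d -> s a = (dot3 h (u b) < 0) ->
    (forall m, m != c -> m != d -> s m = (0 < D c d m)) ->
    (0 <= - dot3 h (u b) * D c d a) /\
    (- dot3 h (u b) * D c d a = 0 -> a = c \/ a = d).
  move=> cd sa hcd.
  have [->|ac] := eqVneq a c; first by rewrite det3_id mulr0; split=> //; left.
  have [->|ad] := eqVneq a d; first by rewrite det3_idr mulr0; split=> //; right.
  have d0 : D c d a != 0 by rewrite det_neq0 // eq_sym.
  have pos : 0 < - dot3 h (u b) * D c d a.
    by rewrite same_sign ?oppr_eq0 // oppr_gt0 -sa hcd.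
  by split; [apply: ltW|move=> e; move: pos; rewrite e ltxx].
have [p1 z1] := side i j k l kl si hkl.
have [p2 z2] := side' j i k l kl sj hkl.
have [p3 _] := side k l i j ij sk hij.
have [p4 _] := side' l k i j ij sl hij.
have sum0 : dot3 h (u j) * D k l i + - dot3 h (u i) * D k l j
    + (dot3 h (u l) * D i j k + - dot3 h (u k) * D i j l) = 0.
  rewrite !(dot3C h); have := plucker (u i) (u j) (u k) (u l) h.
  move=> e; rewrite -[RHS]oppr0 -[in RHS]e.
  by rewrite !det3E; ring.
move/eqP: sum0; rewrite paddr_eq0 ?addr_ge0 // paddr_eq0 //.
move=> /andP[/andP[/eqP/z1 ikl /eqP/z2 jkl] _].
case: ikl => ei; case: jkl => ej; rewrite ei ej // in ij Kij *.
- by rewrite eqxx in ij.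
- by rewrite (negbTE (oriented_corner_asym Kkl)) in Kij.
- by rewrite eqxx in ij.
Qed.

(** Exactly one of the four sign choices at [i] and [j] makes a given vertex first. *)
Lemma sum_first_vertex :
  (\sum_s size_face corner s
   = 4 * \sum_s \sum_i \sum_j (oriented_corner s i j && first_vertex s i j))%N.
Proof.
under eq_bigr => s _ do rewrite -sum_oriented.
rewrite exchange_big [in RHS]exchange_big big_distrr; apply: eq_bigr => i _ /=.
rewrite exchange_big [in RHS]exchange_big big_distrr; apply: eq_bigr => j _ /=.
have [ij|ij] := eqVneq i j.
  by rewrite !big1 // => s _; rewrite /oriented_corner ij eqxx.
pose F s : nat := oriented_corner s i j && first_vertex s i j.
have Fi : (\sum_s F (flip i s) = \sum_s F s)%N.
  by rewrite [RHS](reindex_inj (inv_inj (flipK i))).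
have Fj : (\sum_s F (flip j s) = \sum_s F s)%N.
  by rewrite [RHS](reindex_inj (inv_inj (flipK j))).
have Fij : (\sum_s F (flip i (flip j s)) = \sum_s F s)%N.
  by rewrite -Fi [RHS](reindex_inj (inv_inj (flipK j))).
have -> : (4 * \sum_s F s = \sum_s (F s + F (flip i s)
                              + (F (flip j s) + F (flip i (flip j s)))))%N.
  by rewrite !big_split /= Fi Fj Fij !addnn -!mul2n mulnA.
apply: eq_bigr => s _; rewrite /F !oriented_corner_flip ?inE ?eqxx ?orbT //.
case: oriented_corner => //; rewrite /first_vertex !flip_id.
rewrite !(flip_neq _ ij) !(@flip_neq _ i j) 1?eq_sym // !flip_id.
by move: (s i) (s j) (0 < _) (_ < 0) => [] [] [] [].
Qed.

Definition sweep_face : sgn := [ffun i => 0 < dot3 h (u i)].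

(** In the face of [h] the two conditions would make h.u_i > 0 and h.u_i < 0 equivalent. *)
Lemma first_vertex_le s :
  (\sum_i \sum_j (oriented_corner s i j && first_vertex s i j)
   <= (edges corner s != set0) && (s != sweep_face))%N.
Proof.
rewrite pair_bigA /=.
have [[i j] /= /andP[K F]|none] :=
    pickP [pred x : 'I_n * 'I_n | oriented_corner s x.1 x.2 && first_vertex s x.1 x.2];
    last by rewrite big1 // => x _; have := none x; rewrite /= => ->.
rewrite (bigD1 (i, j)) //= K F big1 => [|[k l] /= ne]; last first.
  apply/eqP; rewrite eqb0; apply: contra ne => /andP[K' F'].
  by have [-> ->] := first_vertex_uniq K' F' K F.
rewrite addn0 lt0b; apply/andP; split.
  by apply/set0Pn; exists i; rewrite inE; apply/existsP; exists j; rewrite /corner K.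
apply: contraL F => /eqP ->; rewrite /first_vertex !ffunE.
by case: (ltgtP (dot3 h (u i)) 0) (h_generic i) => //; case: (0 < _).
Qed.

(** The sizes add up to four times the number of first vertices, which is at most the number of
    faces less one, for the face of [h]. *)
Lemma sum_size_lt : edges corner sweep_face != set0 ->
  \sum_(s | edges corner s != set0) ((size_face corner s)%:Z - 4) < 0.
Proof.
move=> ne; set P := fun s => edges corner s != set0.
have H : (\sum_(s | P s) size_face corner s + 4 <= \sum_(s | P s) 4)%N.
  have -> : (\sum_(s | P s) size_face corner s = \sum_s size_face corner s)%N.
    rewrite [RHS](bigID P) /= [X in (_ + X)%N]big1 ?addn0 // => s.
    by rewrite negbK /size_face => /eqP ->; rewrite cards0.
  rewrite sum_first_vertex sum_nat_const -mulnSr [leqRHS]mulnC leq_mul2l /=.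
  rewrite -sum1_card [ltnRHS](bigD1 sweep_face) //= add1n ltnS.
  rewrite [leqRHS]big_mkcond; apply: leq_sum => s _.
  apply: leq_trans (first_vertex_le s) _.
  by rewrite unfold_in /P; do 2!case: (_ != _).
rewrite sumrB -(big_morph Posz PoszD (erefl _)).
have -> : \sum_(s | P s) (4 : int) = Posz (\sum_(s | P s) 4)%N.
  by rewrite (big_morph Posz PoszD (erefl _)).
by rewrite subr_lt0 ltz_nat; apply: leq_trans H; rewrite -addn1 leq_add2l.
Qed.

End Sweep.

(** A direction close to the corner of [a] and [b], moved off both circles, lies in a face with this
    corner. *)
Lemma sweep_direction : exists h : 'rV[R]_3,
  (forall i, dot3 h (u i) != 0) /\ edges corner (sweep_face h) != set0.
Proof.
pose a : 'I_n := Ordinal (ltnW (ltnW n_gt2)); pose b : 'I_n := Ordinal (ltnW n_gt2).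
pose c : 'I_n := Ordinal n_gt2.
have ab : a != b by []; have bc : b != c by []; have ac : a != c by [].
(* The perturbation has nonzero products with [u a] and [u b]. *)
pose y := cross (u b) (u c) + cross (u a) (u c).
(* So large that the corner outweighs [y] at every other circle; for [a] and [b] the quotient is a
   division by 0, with value 0. *)
pose e := 1 + \sum_m `|dot3 y (u m)| / `|D a b m|.
have e_gt0 : 0 < e.
  by rewrite ltr_pwDl // sumr_ge0 // => m _; rewrite divr_ge0.
pose h := e *: cross (u a) (u b) + y.
have hE m : dot3 h (u m) = e * D a b m + dot3 y (u m).
  by rewrite /h dot3Dl dot3Zl.
have ya : dot3 y (u a) = D b c a by rewrite dot3Dl -!/(det3 _ _ _) det3_id addr0.
have yb : dot3 y (u b) = D a c b by rewrite dot3Dl -!/(det3 _ _ _) det3_id add0r.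
have small m : m != a -> m != b -> `|dot3 y (u m)| < e * `|D a b m|.
  move=> ma mb; have d0 : D a b m != 0 by rewrite det_neq0 // eq_sym.
  rewrite -ltr_pdivrMr ?normr_gt0 // /e (bigD1 m) //=.
  rewrite addrCA ltrDl ltr_pwDl // sumr_ge0 // => k _; rewrite divr_ge0 //.
have signs m : m != a -> m != b -> dot3 h (u m) != 0 /\
    (0 < dot3 h (u m)) = (0 < D a b m).
  move=> ma mb; have := small m ma mb; rewrite hE.
  have d0 : D a b m != 0 by rewrite det_neq0 // eq_sym.
  move: d0; rewrite neq_lt ltr_norml => /orP[dn|dp].
    rewrite (ltr0_norm dn) => /andP[_ lt]; have neg : e * D a b m + dot3 y (u m) < 0.
      by move: lt; rewrite mulrN; lra.
    by rewrite lt_eqF // !ltNge (ltW neg) (ltW dn).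
  rewrite (gtr0_norm dp) => /andP[lt _]; have pos : 0 < e * D a b m + dot3 y (u m).
    by move: lt; lra.
  by rewrite gt_eqF // pos dp.
exists h; split=> [i|].
  have [->|ia] := eqVneq i a.
    by rewrite hE det3_id mulr0 add0r ya det_neq0.
  have [->|ib] := eqVneq i b.
    by rewrite hE det3_idr mulr0 add0r yb det_neq0.
  by have [] := signs i ia ib.
apply/set0Pn; exists a; rewrite inE; apply/existsP; exists b; apply/orP; left.
apply/oriented_cornerP; split=> // m ma mb.
by rewrite ffunE; have [_ ->] := signs m ma mb.
Qed.

(** * A vertex of small total and its merged face *)

Lemma light_vertex : (4 < n)%N -> exists s i j, oriented_corner s i j /\
  (size_face corner s + size_face corner (flip i s)
   + size_face corner (flip i (flip j s)) + size_face corner (flip j s) <= 17)%N.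
Proof.
move=> n_gt4; pose total s i j := (size_face corner s + size_face corner (flip i s)
   + size_face corner (flip i (flip j s)) + size_face corner (flip j s))%N.
have totalC s i j : total s i j = total s j i by rewrite /total (flipC i j s); lia.
have [[[s i] j] /= /andP[K le17]|none] := pickP [pred x : sgn * 'I_n * 'I_n |
    oriented_corner x.1.1 x.1.2 x.2 && (total x.1.1 x.1.2 x.2 <= 17)%N].
  by exists s, i, j.
have ge18 s i j : corner s i j -> (18 <= total s i j)%N.
  rewrite ltnNge => /orP[] K; apply/negP => le17.
    by have := none (s, i, j); rewrite /= K le17.
  by have := none (s, j, i); rewrite /= K totalC le17.
have := discharging corner_irr corner_sym corner_flip corner_degree corner_uniq n_gt4 ge18.
have [h [h_generic h_face]] := sweep_direction.
by rewrite leNgt (sum_size_lt h_generic h_face).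
Qed.

(** A point [p] of the merged face's edge on [k] lies in the closure of one of the four faces, and
    by [cramer] on at most one further circle; so [edge_degree] makes [k] an edge of that face. *)
Lemma face_edge_circle_edges s i j k : oriented_corner s i j ->
  face_edge_circle u (~: [set i; j]) (normalize (cross (u i) (u j))) k ->
  k \in (edges corner s :|: edges corner (flip i s)
         :|: (edges corner (flip j s) :|: edges corner (flip i (flip j s))))
        :\: [set i; j].
Proof.
move=> K [kij [p [[psph kp] psign]]]; have [ij Kij] := oriented_cornerP _ _ _ K.
rewrite in_setC in kij; rewrite in_setD kij /=.
have X0 : cross (u i) (u j) != 0.
  have [m /andP[mi mj]] := third i j.
  have : D i j m != 0 by rewrite det_neq0 // eq_sym.
  apply: contra => /eqP X0; rewrite /det3 X0 -(scale0r (0 : 'rV[R]_3)) dot3Zl.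
  by rewrite mul0r.
(* The sign vector of a face at the vertex whose closure contains [p]; the signs
   of [p] at [i] and [j] may vanish. *)
pose t : sgn := [ffun m => if m \in [set i; j] then 0 < dot3 (u m) p else s m].
have kt : k \in edges corner t.
  have deg : #|[set l | corner t k l]| = 2%N.
    apply: (@edge_degree t k p kp) => [m mk|m l mk lk ml].
      rewrite ffunE; case: ifP => [_|mij].
        rewrite /sg; case: (ltP 0 (dot3 (u m) p)) => [lt|le].
          by rewrite mul1r ltW.
        by rewrite mulN1r oppr_ge0.
      have mij' : m \in ~: [set i; j] by rewrite in_setC mij.
      move/negbT: mij; rewrite !inE negb_or => /andP[mi mj].
      have := psign m mij' mk; rewrite [dot3 _ (normalize _)]dot3C dot3Zl.
      rewrite -/(det3 _ _ _) mulrCA pmulr_rgt0 ?inv_norm_gt0 // (Kij m mi mj) => pos.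
      have : D i j m != 0 by rewrite det_neq0 // eq_sym.
      rewrite neq_lt => /orP[d|d]; move: pos.
        by rewrite nmulr_lgt0 // [0 < D i j m]lt_gtF // mulN1r oppr_ge0 => /ltW.
      by rewrite pmulr_lgt0 // d mul1r => /ltW.
    rewrite -negb_and; apply/negP => /andP[/eqP m0 /eqP l0].
    have := cramer (u k) (u m) (u l) p.
    rewrite kp m0 l0 psph !mul0r !addr0 mulr1 => /eqP.
    by rewrite (negbTE (det_neq0 _ _ _)) // eq_sym.
  have : [set l | corner t k l] != set0 by rewrite -card_gt0 deg.
  by case/set0Pn => l; rewrite !inE => c; apply/existsP; exists l.
have tE : t = (if s i == t i then id else flip i) ((if s j == t j then id else flip j) s).
  have ti m : m != i -> m != j -> t m = s m.
    by move=> mi mj; rewrite ffunE !inE (negbTE mi) (negbTE mj).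
  apply/ffunP => m; have [->|mi] := eqVneq m i.
    have idj (r : sgn) : flip j r i = r i by rewrite flip_neq.
    case: eqP => [<-|ne]; case: (_ == t j); rewrite ?flip_id ?idj //;
      by move: ne; case: (s i); case: (t i).
  have [->|mj] := eqVneq m j.
    have idi (r : sgn) : flip i r j = r j by rewrite flip_neq // eq_sym.
    case: (_ == t i); rewrite ?idi; case: eqP => [//|ne]; rewrite flip_id;
      by move: ne; case: (s j); case: (t j).
  by do 2!case: (_ == _); rewrite ?flip_neq // ti.
move: kt; rewrite tE; case: (_ == t i); case: (_ == t j) => kt; rewrite !in_setU kt ?orbT //.
Qed.

End Arrangement.

Theorem theorem2 (R : realType) (n : nat) (u : 'I_n -> 'rV[R]_3) :
  (2 <= n)%N ->
  great_circle_family u ->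
  general_position u ->
  exists (i j : 'I_n) (v : 'rV[R]_3),
    is_vertex_on u i j v /\ (Cv u i j v <= 5)%N.
Proof.
move=> n_ge2 [u_neq0 circles] gp.
have cross_neq0 i j : i != j -> cross (u i) (u j) != 0.
  move=> ij; apply/eqP => X0; have [p [[psph ip] np]] := circles i j ij.
  by apply: np; split=> //; apply: cross_eq0 X0 (u_neq0 i) ip.
have vertexP i j : i != j -> is_vertex_on u i j (normalize (cross (u i) (u j))).
  move=> ij; split=> //; split; apply: on_circle_normalize; rewrite ?cross_neq0 //.
    by rewrite dot3C -/(det3 _ _ _) det3_id.
  by rewrite dot3C -/(det3 _ _ _) det3_idr.
have det_neq0 (i j k : 'I_n) : i != j -> j != k -> i != k ->
    det3 (u i) (u j) (u k) != 0.
  move=> ij jk ik; apply/eqP => d0; apply: (gp i j k ij jk ik).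
  have [_ [vi vj]] := vertexP i j ij.
  exists (normalize (cross (u i) (u j))); split=> //; split=> //.
  by apply: on_circle_normalize; rewrite ?cross_neq0 // dot3C.
(* For n <= 7 at most five circles remain, so any vertex will do. *)
have [n_gt7|n_le7] := ltnP 7 n; last first.
  pose i : 'I_n := Ordinal (ltnW n_ge2); pose j : 'I_n := Ordinal n_ge2.
  have ij : i != j by [].
  exists i, j, (normalize (cross (u i) (u j))); split; first exact: vertexP.
  rewrite /Cv /face_size (@leq_trans #|~: [set i; j]|) //.
    by apply: subset_leq_card; apply/subsetP => k; rewrite inE => /asboolP[].
  by rewrite cardsCs setCK cards2 ij card_ord; lia.
have n_gt2 : (2 < n)%N by lia.
have n_gt4 : (4 < n)%N by lia.
have [s [i [j [K le17]]]] := light_vertex n_gt2 det_neq0 n_gt4.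
have [ij _] := oriented_cornerP _ _ _ _ K.
exists i, j, (normalize (cross (u i) (u j))); split; first exact: vertexP.
have c : corner u s i j by rewrite /corner K.
have := edges_around_vertex (@corner_irr _ _ u) (@corner_sym _ _ u) (@corner_flip _ _ u)
  (corner_degree n_gt2 det_neq0) (corner_uniq det_neq0) n_gt4 c.
move=> /leq_trans/(_ le17) le_edges.
(* The total of at most 17 exceeds the number of edges by at least 12, which leaves 5. *)
rewrite /Cv /face_size -(leq_add2r 12); apply: leq_trans le_edges.
rewrite leq_add2r; apply: subset_leq_card; apply/subsetP => k.
rewrite inE => /asboolP; exact: face_edge_circle_edges.
Qed.
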